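(* Let $\alpha,a\in\mathbb{R}$. For all integers $0\le\nu\le l$ and all $x\in\mathbb{R}$, with $\lambda_{\nu}=\nu(2a+\nu+1)$, $$\frac{d}{dx}\left(\sigma(x)^{l-\nu+1}w_l(x)\frac{dQ_{\nu}^{(\alpha,-a)}(x)}{dx}\right)=-\lambda_{\nu}\,\sigma(x)^{l-\nu}w_l(x)\,Q_{\nu}^{(\alpha,-a)}(x).$$
   Context: Throughout $x$ is a real variable, $\alpha,a$ are real parameters, $\sigma(x)=1+x^2$, and $\cot^{-1}:\mathbb{R}\to(0,\pi)$ is the smooth branch, so that $\frac{d}{dx}\cot^{-1}x=-1/\sigma(x)$. For integers $l\ge 0$ put $w_l(x)=\sigma(x)^{-(l+a+1)}e^{-\alpha\cot^{-1}x}=\sigma(x)^{-l}w_0(x)$. Define $P_l^{(a,\alpha)}(x)=\frac{1}{w_l(x)}\frac{d^l}{dx^l}[w_l(x)\sigma(x)^l]=\frac{\sigma(x)^l}{w_0(x)}\frac{d^l w_0(x)}{dx^l}$. The complementary (Romanovski) polynomials $Q_\nu^{(\alpha,-a)}$, with $Q_0^{(\alpha,-a)}\equiv 1$, are defined by the Rodrigues representation $P_l^{(a,\alpha)}(x)=\frac{1}{w_l(x)}\frac{d^{l-\nu}}{dx^{l-\nu}}[\sigma(x)^{l-\nu}w_l(x)Q_\nu^{(\alpha,-a)}(x)]$ for all integers $0\le\nu\le l$ (the case $l=\nu$ reads $Q_\nu^{(\alpha,-a)}=P_\nu^{(a,\alpha)}$). The second upper index is minus the parameter $a$ of the weight. 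*)

(* Defs.v *)
From Stdlib Require Import Reals Lra Lia.
From Coquelicot Require Import Coquelicot.
Open Scope R_scope.

Definition sigma2 (x : R) : R := 1 + x ^ 2.

Definition acot (x : R) : R := PI / 2 - atan x.

Lemma acot_bound x : 0 < acot x < PI.
Proof. unfold acot; pose proof (atan_bound x); lra. Qed.

Lemma cot_acot x : cos (acot x) / sin (acot x) = x.
Proof.
  unfold acot. rewrite cos_shift, sin_shift.
  change (tan (atan x) = x). apply tan_atan.
Qed.

Lemma sigma2_pos x : 0 < sigma2 x.
Proof. unfold sigma2; pose proof (pow2_ge_0 x); lra. Qed.

Lemma is_derive_acot (x : R) : is_derive acot x (- 1 / sigma2 x).
Proof.
  assert (H : is_derive atan x (/ (1 + x ^ 2))).
  { apply is_derive_Reals.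
    apply derivable_pt_lim_atan. }
  replace (- 1 / sigma2 x) with (0 - / (1 + x ^ 2)).
  - apply (is_derive_minus (fun _ => PI / 2) atan x 0); auto.
    exact (is_derive_const (PI / 2) x).
  - pose proof (sigma2_pos x). unfold sigma2 in *. field; lra.
Qed.

Definition weight (a alpha : R) (l : nat) (x : R) : R :=
  Rpower (sigma2 x) (- (INR l + a + 1)) * exp (- alpha * acot x).

Lemma weight_pos a alpha l x : 0 < weight a alpha l x.
Proof. apply Rmult_lt_0_compat; apply exp_pos. Qed.

Lemma weight_mul_pow a alpha k n x :
  weight a alpha (k + n) x * sigma2 x ^ k = weight a alpha n x.
Proof.
  unfold weight.
  rewrite <- (Rpower_pow k (sigma2 x) (sigma2_pos x)).
  replace (- (INR n + a + 1)) with (- (INR (k + n) + a + 1) + INR k)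
    by (rewrite plus_INR; ring).
  rewrite Rpower_plus; ring.
Qed.

Definition romanovski (a alpha : R) (l : nat) (x : R) : R :=
  / weight a alpha l x *
  Derive_n (fun t => weight a alpha l t * sigma2 t ^ l) l x.

Lemma romanovski_weight0 a alpha l x :
  romanovski a alpha l x =
  sigma2 x ^ l / weight a alpha 0 x * Derive_n (weight a alpha 0) l x.
Proof.
  assert (E : forall t, weight a alpha l t * sigma2 t ^ l = weight a alpha 0 t).
  { intro t. rewrite <- (weight_mul_pow a alpha l 0 t).
    now rewrite Nat.add_0_r. }
  unfold romanovski. rewrite (Derive_n_ext _ _ l x E), <- (E x).
  pose proof (weight_pos a alpha l x).
  pose proof (pow_lt _ l (sigma2_pos x)).
  field; lra.
Qed.

(* [Q nu] is the polynomial usually written Q_nu^(alpha, -a): its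
   second upper index is minus the parameter [a] of the weight. *)
Definition complementary_romanovski (a alpha : R) (Q : nat -> R -> R) : Prop :=
  (forall x, Q 0%nat x = 1) /\
  forall nu l : nat, (nu <= l)%nat -> forall x,
    romanovski a alpha l x =
    / weight a alpha l x *
    Derive_n (fun t => sigma2 t ^ (l - nu) * weight a alpha l t * Q nu t)
      (l - nu) x.

Lemma complementary_romanovski_unique a alpha Q :
  complementary_romanovski a alpha Q ->
  forall nu x, Q nu x = romanovski a alpha nu x.
Proof.
  intros [_ H] nu x. rewrite (H nu nu (le_n nu)), Nat.sub_diag; simpl.
  pose proof (weight_pos a alpha nu x). field; lra.
Qed.

(* The Rodrigues representations overdetermine [Q]; they are consistent. *)
Lemma complementary_romanovski_exists a alpha :
  complementary_romanovski a alpha (romanovski a alpha).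
Proof.
  split.
  - intro x. unfold romanovski; simpl.
    pose proof (weight_pos a alpha 0 x). field; lra.
  - intros nu l Hl x.
    assert (E : forall t, sigma2 t ^ (l - nu) * weight a alpha l t *
        romanovski a alpha nu t = Derive_n (weight a alpha 0) nu t).
    { intro t. rewrite (Rmult_comm (sigma2 t ^ _)).
      replace (weight a alpha l t) with (weight a alpha ((l - nu) + nu) t)
        by (do 2 f_equal; lia).
      rewrite weight_mul_pow, romanovski_weight0.
      rewrite <- (weight_mul_pow a alpha nu 0 t), Nat.add_0_r.
      pose proof (weight_pos a alpha nu t).
      pose proof (pow_lt _ nu (sigma2_pos t)).
      field; lra. }
    rewrite (Derive_n_ext _ _ _ x E), Derive_n_comp.
    replace (l - nu + nu)%nat with l by lia.
    unfold romanovski. f_equal. apply Derive_n_ext. intro t.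
    rewrite <- (weight_mul_pow a alpha l 0 t). now rewrite Nat.add_0_r.
Qed.

(* Main.v *)
Require Import Defs.
From Stdlib Require Import Reals Lra Lia.
From Coquelicot Require Import Coquelicot.
Open Scope R_scope.

(** Write [D n] for the [n]-th derivative of [w_0], [tau_n = alpha - 2 (a+1+n) x]
    and [lambda_n = n (2a+n+1)].  Two facts carry the proof.

    The weights satisfy the Pearson equation [sigma w_n' = tau_n w_n]
    ([is_derive_weight]).  Differentiating its case [sigma w_0' = tau_0 w_0]
    [n] times gives the three-term recurrence
    [sigma D_(n+1) = tau_n D_n - lambda_n D_(n-1)]
    ([weight_derivative_recurrence]).

    On the other hand [w_nu Q_nu = D_nu].  The quotient rule and the Pearson
    equation for [w_nu] give [sigma w_nu Q_nu' = sigma D_(nu+1) - tau_nu D_nu],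
    which the recurrence collapses to [- lambda_nu D_(nu-1)]
    ([flux_as_weight_derivative]).  One more derivative gives
    [- lambda_nu D_nu = - lambda_nu w_nu Q_nu], the claimed equation, because
    [sigma^(l-nu) w_l = w_nu] removes [l] from the problem. *)

Definition eigenvalue (a : R) (n : nat) : R := INR n * (2 * a + INR n + 1).

Definition pearson_tau (a alpha : R) (n : nat) (x : R) : R :=
  alpha - 2 * (a + 1 + INR n) * x.

Definition weight_derivative (a alpha : R) (n : nat) : R -> R :=
  Derive_n (weight a alpha 0) n.

Lemma is_derive_sigma2 x : is_derive sigma2 x (2 * x).
Proof. unfold sigma2; auto_derive; [trivial | ring]. Qed.

Lemma is_derive_pearson_tau a alpha n x :
  is_derive (pearson_tau a alpha n) x (- 2 * (a + 1 + INR n)).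
Proof. unfold pearson_tau; auto_derive; [trivial | ring]. Qed.

Lemma is_derive_weight a alpha n x :
  is_derive (weight a alpha n) x
    (pearson_tau a alpha n x / sigma2 x * weight a alpha n x).
Proof.
  pose proof (sigma2_pos x) as Hs.
  pose proof (is_derive_acot x) as Hc.
  unfold weight, Rpower, pearson_tau.
  auto_derive.
  - repeat split; trivial.
    + exists (2 * x); apply is_derive_sigma2.
    + now exists (- 1 / sigma2 x).
  - rewrite (is_derive_unique (fun x0 : R => sigma2 x0) x _ (is_derive_sigma2 x)).
    rewrite (is_derive_unique (fun x0 : R => acot x0) x _ Hc).
    field; lra.
Qed.

(** The term carrying [eigenvalue a n] is differentiable and behaves uniformly
    in [n]: for [n = 0], where [pred n] is again [0], the coefficient vanishes. *)
Lemma is_derive_eigenvalue_weight_derivative a alpha n x :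
  (forall m, (m < n)%nat -> ex_derive (weight_derivative a alpha m) x) ->
  is_derive (fun t => eigenvalue a n * weight_derivative a alpha (pred n) t) x
    (eigenvalue a n * weight_derivative a alpha n x).
Proof.
  intros Hdiff. destruct n as [|n].
  - replace (eigenvalue a 0) with 0 by (unfold eigenvalue; simpl; ring).
    apply (is_derive_ext (fun _ => 0)); [intro t; symmetry; apply Rmult_0_l|].
    rewrite Rmult_0_l. exact (is_derive_const 0 x).
  - apply is_derive_scal. apply (Derive_correct (weight_derivative a alpha n)).
    apply Hdiff; lia.
Qed.

(** Smoothness and recurrence are proved together: the recurrence expresses
    [D_(n+1)] through lower derivatives divided by [sigma], which makes it
    differentiable, and differentiating that identity gives the next recurrence,
    since [eigenvalue a (n+1) = eigenvalue a n + 2 (a+1+n)]. *)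
Lemma weight_derivative_smooth_recurrence a alpha n :
  (forall m x, (m <= n)%nat -> ex_derive (weight_derivative a alpha m) x) /\
  (forall x, sigma2 x * weight_derivative a alpha (S n) x =
     pearson_tau a alpha n x * weight_derivative a alpha n x
     - eigenvalue a n * weight_derivative a alpha (pred n) x).
Proof.
  induction n as [|n [Hdiff Hrec]].
  - split.
    + intros m x Hm. replace m with 0%nat by lia.
      eexists. exact (is_derive_weight a alpha 0 x).
    + intro x. unfold weight_derivative; simpl.
      rewrite (is_derive_unique (fun x0 : R => weight a alpha 0 x0) x _
                 (is_derive_weight a alpha 0 x)).
      pose proof (sigma2_pos x). unfold eigenvalue; simpl. field; lra.
  - assert (Hnum : forall x, is_derive
      (fun t => pearson_tau a alpha n t * weight_derivative a alpha n t
                - eigenvalue a n * weight_derivative a alpha (pred n) t) x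
      (- 2 * (a + 1 + INR n) * weight_derivative a alpha n x
       + pearson_tau a alpha n x * weight_derivative a alpha (S n) x
       - eigenvalue a n * weight_derivative a alpha n x)).
    { intro x. refine (is_derive_minus _ _ _ _ _ _ _).
      - refine (is_derive_mult _ _ _ _ _ _ _ _).
        + apply is_derive_pearson_tau.
        + apply (Derive_correct (weight_derivative a alpha n)), Hdiff; lia.
        + exact Rmult_comm.
      - apply is_derive_eigenvalue_weight_derivative.
        intros m Hm; apply Hdiff; lia. }
    assert (Hsmooth : forall x, ex_derive (weight_derivative a alpha (S n)) x).
    { intro x.
      apply (ex_derive_ext (fun t =>
        (pearson_tau a alpha n t * weight_derivative a alpha n t
         - eigenvalue a n * weight_derivative a alpha (pred n) t) / sigma2 t)).
      - intro t. rewrite <- Hrec. pose proof (sigma2_pos t).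
        (* [field] must see the equation at [R] rather than at its normed module. *)
        refine (_ : @eq R _ _). field; lra.
      - apply ex_derive_div.
        + eexists; apply Hnum.
        + eexists; apply is_derive_sigma2.
        + pose proof (sigma2_pos x); lra. }
    split.
    + intros m x Hm. destruct (Nat.eq_dec m (S n)) as [-> | Hne].
      * apply Hsmooth.
      * apply Hdiff; lia.
    + intro x.
      assert (Hprod : is_derive
        (fun t => sigma2 t * weight_derivative a alpha (S n) t) x
        (2 * x * weight_derivative a alpha (S n) x
         + sigma2 x * weight_derivative a alpha (S (S n)) x)).
      { refine (is_derive_mult _ _ _ _ _ _ _ _).
        - apply is_derive_sigma2.
        - apply (Derive_correct (weight_derivative a alpha (S n))), Hsmooth.
        - exact Rmult_comm. }
      pose proof (eq_trans (eq_sym (is_derive_unique _ _ _ (Hnum x)))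
        (is_derive_unique _ _ _ (is_derive_ext _ _ _ _ Hrec Hprod))) as Heq.
      unfold pearson_tau, eigenvalue in *. rewrite S_INR. simpl pred. lra.
Qed.

Lemma ex_derive_weight_derivative a alpha n x :
  ex_derive (weight_derivative a alpha n) x.
Proof.
  now apply (proj1 (weight_derivative_smooth_recurrence a alpha n)).
Qed.

Lemma weight_derivative_recurrence a alpha n x :
  sigma2 x * weight_derivative a alpha (S n) x =
  pearson_tau a alpha n x * weight_derivative a alpha n x
  - eigenvalue a n * weight_derivative a alpha (pred n) x.
Proof. apply weight_derivative_smooth_recurrence. Qed.

Lemma romanovski_quotient a alpha n x :
  romanovski a alpha n x = weight_derivative a alpha n x / weight a alpha n x.
Proof.
  rewrite romanovski_weight0, <- (weight_mul_pow a alpha n 0 x), Nat.add_0_r.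
  pose proof (weight_pos a alpha n x).
  pose proof (pow_lt _ n (sigma2_pos x)).
  unfold weight_derivative. field; lra.
Qed.

Lemma is_derive_romanovski a alpha n x :
  is_derive (romanovski a alpha n) x
    (- eigenvalue a n * weight_derivative a alpha (pred n) x
     / (sigma2 x * weight a alpha n x)).
Proof.
  pose proof (weight_pos a alpha n x) as Hw.
  pose proof (sigma2_pos x) as Hs.
  apply (is_derive_ext
    (fun t => weight_derivative a alpha n t / weight a alpha n t)).
  - intro t; symmetry; apply romanovski_quotient.
  - replace (- eigenvalue a n * weight_derivative a alpha (pred n) x)
      with (sigma2 x * weight_derivative a alpha (S n) x
            - pearson_tau a alpha n x * weight_derivative a alpha n x)
      by (rewrite weight_derivative_recurrence; ring).
    evar_last.
    + apply is_derive_div.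
      * apply (Derive_correct (weight_derivative a alpha n)).
        apply ex_derive_weight_derivative.
      * apply is_derive_weight.
      * lra.
    + change (Derive (weight_derivative a alpha n) x)
        with (weight_derivative a alpha (S n) x).
      field; lra.
Qed.

(** Up to the factor [- lambda_n], the quantity differentiated in the
    Sturm-Liouville operator is an antiderivative of [w_n P_n = D_n]. *)
Lemma flux_as_weight_derivative a alpha n x :
  sigma2 x * weight a alpha n x * Derive (romanovski a alpha n) x =
  - (eigenvalue a n * weight_derivative a alpha (pred n) x).
Proof.
  rewrite (is_derive_unique _ _ _ (is_derive_romanovski a alpha n x)).
  pose proof (weight_pos a alpha n x). pose proof (sigma2_pos x).
  field; lra.
Qed.

Lemma pow_sub_mul_weight a alpha n l x : (n <= l)%nat ->
  sigma2 x ^ (l - n) * weight a alpha l x = weight a alpha n x.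
Proof.
  intro Hn. rewrite <- (weight_mul_pow a alpha (l - n) n x).
  replace (l - n + n)%nat with l by lia. ring.
Qed.

Theorem theorem1p9 (alpha a : R) (Q : nat -> R -> R)
    (HQ : complementary_romanovski a alpha Q)
    (nu l : nat) (Hnu : (nu <= l)%nat) (x : R) :
  let lambda := INR nu * (2 * a + INR nu + 1) in
  ex_derive (Q nu) x /\
  is_derive
    (fun t : R => sigma2 t ^ (l - nu + 1) * weight a alpha l t * Derive (Q nu) t) x
    (- lambda * (sigma2 x ^ (l - nu) * weight a alpha l x * Q nu x)).
Proof.
  intro lambda.
  pose proof (complementary_romanovski_unique a alpha Q HQ nu) as EQ.
  split.
  - apply (ex_derive_ext (romanovski a alpha nu)).
    + intro t; symmetry; apply EQ.
    + eexists; apply is_derive_romanovski.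
  - apply (is_derive_ext
      (fun t => - (eigenvalue a nu * weight_derivative a alpha (pred nu) t))).
    + intro t. rewrite (Derive_ext _ _ t EQ), <- flux_as_weight_derivative.
      rewrite <- (pow_sub_mul_weight a alpha nu l t Hnu), pow_add.
      refine (_ : @eq R _ _). ring.
    + rewrite (pow_sub_mul_weight a alpha nu l x Hnu), EQ, romanovski_quotient.
      replace (- lambda * _)
        with (- (eigenvalue a nu * weight_derivative a alpha nu x)).
      * refine (is_derive_opp _ _ _ _). apply is_derive_eigenvalue_weight_derivative.
        intros; apply ex_derive_weight_derivative.
      * pose proof (weight_pos a alpha nu x).
        unfold lambda, eigenvalue. field; lra.
Qed.
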